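(* Let $G$ and $H$ be graphs and let $k,\ell$ be positive integers. Then $$\left\lceil \frac{\Delta(G)\Delta(H)}{2}\right\rceil\leq {\rm la}_{\max\{k,\ell\}}(G\times H)\leq 2\,{\rm la}_{k}(G)\,{\rm la}_{\ell}(H).$$ Moreover, the bounds are sharp.
   Context: All graphs are finite, simple and undirected; $\Delta(G)$ denotes the maximum degree. A linear $k$-forest is a forest each of whose components is a path of length (number of edges) at most $k$. The linear $k$-arboricity ${\rm la}_k(G)$ of a graph $G$ is the least number of linear $k$-forests (subgraphs of $G$) whose edge sets partition $E(G)$. The direct product $G\times H$ has vertex set $V(G)\times V(H)$, with $(u,v)$ adjacent to $(u',v')$ iff $uu'\in E(G)$ and $vv'\in E(H)$. *)

(* Defs.v *)
From mathcomp Require Import all_boot.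

Set Implicit Arguments.
Unset Strict Implicit.
Unset Printing Implicit Defensive.

Record sgraph := SGraph {
  vertex :> finType;
  adj : rel vertex;
  adj_sym : symmetric adj;
  adj_irrefl : irreflexive adj }.

Definition edges (G : sgraph) : {set {set G}} :=
  [set [set p.1; p.2] | p : G * G & adj p.1 p.2].

Definition degree (G : sgraph) (x : G) : nat := #|[set y | adj x y]|.

Definition max_degree (G : sgraph) : nat := \max_(x : G) degree x.

Definition dprod_adj (G H : sgraph) : rel (G * H)%type :=
  [rel p q | adj p.1 q.1 && adj p.2 q.2].

Lemma dprod_adj_sym (G H : sgraph) : symmetric (@dprod_adj G H).
Proof. by move=> p q; rewrite /dprod_adj /= adj_sym [adj p.2 _]adj_sym. Qed.

Lemma dprod_adj_irrefl (G H : sgraph) : irreflexive (@dprod_adj G H).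
Proof. by move=> p; rewrite /dprod_adj /= adj_irrefl. Qed.

Definition direct_product (G H : sgraph) : sgraph :=
  SGraph (@dprod_adj_sym G H) (@dprod_adj_irrefl G H).

(* The spanning subgraph with edge set S. Keeping all the vertices of G is    *)
(* harmless below: an isolated vertex is a path of length 0.                  *)
Definition sub_adj (G : sgraph) (S : {set {set G}}) : rel G :=
  [rel x y | adj x y && ([set x; y] \in S)].

Lemma sub_adj_sym (G : sgraph) (S : {set {set G}}) : symmetric (sub_adj S).
Proof. by move=> x y; rewrite /sub_adj /= adj_sym setUC. Qed.

Lemma sub_adj_irrefl (G : sgraph) (S : {set {set G}}) :
  irreflexive (sub_adj S).
Proof. by move=> x; rewrite /sub_adj /= adj_irrefl. Qed.

Definition edge_subgraph (G : sgraph) (S : {set {set G}}) : sgraph :=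
  SGraph (sub_adj_sym S) (sub_adj_irrefl S).

Definition component (G : sgraph) (x : G) : {set G} :=
  [set y | connect (@adj G) x y].

(* A cycle has distinct vertices, hence length at most #|G|. *)
Definition forest (G : sgraph) : bool :=
  [forall m : 'I_#|G|.+1, forall c : m.-tuple G,
     (2 < m) ==> ~~ ucycleb (@adj G) c].

(* The subgraph of G induced by C is a path with m edges. *)
Definition induces_path (G : sgraph) (m : nat) (C : {set G}) : bool :=
  [exists t : m.+1.-tuple G,
     [&& uniq t, C == [set x in t] &
      [forall i, forall j,
         adj (tnth t i) (tnth t j) ==
           ((i.+1 == j :> nat) || (j.+1 == i :> nat))]]].

Definition linear_forest (k : nat) (G : sgraph) : bool :=
  forest G &&
  [forall x : G, exists m : 'I_k.+1, induces_path m (component x)].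

Definition forest_decomposition (k : nat) (G : sgraph)
    (P : {set {set {set G}}}) : bool :=
  partition P (edges G) &&
  [forall S in P, linear_forest k (edge_subgraph S)].

Definition single_edges (G : sgraph) : {set {set {set G}}} :=
  [set [set e] | e in edges G].

(* For 0 < k the seed single_edges G is a decomposition, so this is the least *)
(* size of one (see laP).                                                     *)
(* For k = 0 the value is meaningless if G has an edge.                       *)
Definition la (k : nat) (G : sgraph) : nat :=
  #|[arg min_(P < single_edges G | forest_decomposition k P) #|P|]|.

Lemma edgesP (G : sgraph) (e : {set G}) :
  reflect (exists x y, adj x y /\ e = [set x; y]) (e \in edges G).
Proof.
apply: (iffP imsetP) => [[[x y]]|[x [y [xy ->]]]].
  by rewrite inE /= => xy ->; exists x, y.
by exists (x, y); rewrite ?inE.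
Qed.

Lemma partition_single_edges (G : sgraph) :
  partition (single_edges G) (edges G).
Proof.
apply/and3P; split.
- apply/eqP/setP=> e; apply/bigcupP/idP => [[S /imsetP[f fE ->]]|eE].
    by rewrite inE => /eqP->.
  by exists [set e]; rewrite ?inE //; apply/imsetP; exists e.
- apply/trivIsetP=> A B /imsetP[e _ ->] /imsetP[f _ ->] nAB.
  by rewrite disjoints1 inE; apply: contra nAB => /eqP->.
- apply/imsetP=> -[e _] /setP /(_ e).
  by rewrite !inE eqxx.
Qed.

Lemma forest_single_edge (G : sgraph) (e : {set G}) :
  e \in edges G -> forest (edge_subgraph [set e]).
Proof.
case/edgesP=> x [y [xy ->]].
apply/forallP=> m; apply/forallP=> c; apply/implyP=> m2; apply/negP.
case/andP=> cyc /card_uniqP cU.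
have: #|c| <= #|[set x; y]|.
  apply/subset_leq_card/subsetP=> z zc.
  move: (next_cycle cyc zc) => /andP[_].
  by move/set1P=> <-; rewrite !inE eqxx.
by rewrite cU size_tuple cards2; case: (_ != _); move: m2; case: (nat_of_ord m) => [|[|[|]]].
Qed.

Lemma forest_decomposition_single_edges (k : nat) (G : sgraph) :
  0 < k -> forest_decomposition k (single_edges G).
Proof.
move=> k0; rewrite /forest_decomposition partition_single_edges /=.
apply/forallP=> S; apply/implyP=> /imsetP[e eE ->].
rewrite /linear_forest forest_single_edge //=; apply/forallP=> z.
case/edgesP: eE => x [y [xy {e}->]].
set F := edge_subgraph _.
have nxy : x != y by apply: contraTneq xy => ->; rewrite adj_irrefl.
have Fadj u v : @adj F u v = (u == x) && (v == y) || (u == y) && (v == x).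
  apply/andP/orP=> [[uv /set1P /setP E]|].
    have := E u; have := E v; have := E x; have := E y; rewrite !inE !eqxx ?orbT /=.
    have nuv : u != v by apply: contraTneq uv => ->; rewrite adj_irrefl.
    move=> _ _ /esym/orP[]/eqP vE /esym/orP[]/eqP uE; move: nuv; rewrite uE vE ?eqxx //.
    - by right.
    - by left.
  by case=> /andP[/eqP-> /eqP->]; split; rewrite ?inE // ?[[set y; x]]setUC // adj_sym.
have [zxy|nzxy] := boolP (z \in [set x; y]); last first.
  apply/existsP; exists ord0; apply/existsP; exists [tuple z].
  apply/and3P; split=> //.
    apply/eqP/setP=> w; rewrite !inE; apply/idP/eqP=> [/connectP[[|u p]]|->].
    - by move=> _ ->.
    - case/andP; rewrite (Fadj z u); move: nzxy; rewrite !inE negb_or.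
      by case/andP=> /negPf-> /negPf->.
    - exact: connect0.
  apply/forallP=> i; apply/forallP=> j; rewrite !ord1 adj_irrefl.
  by [].
have k1 : 1 < k.+1 by [].
apply/existsP; exists (Ordinal k1); apply/existsP; exists [tuple x; y].
apply/and3P; split; first by rewrite /= inE nxy.
  have clo : closed (@adj F) [set x; y].
    move=> u v; rewrite Fadj !inE.
    by case/orP=> /andP[/eqP-> /eqP->]; rewrite !eqxx ?orbT.
  have cxy : connect (@adj F) x y by apply: connect1; rewrite Fadj !eqxx.
  have cyx : connect (@adj F) y x by apply: connect1; rewrite Fadj !eqxx orbT.
  apply/eqP/setP=> w; rewrite !inE.
  apply/idP/idP=> [/(closed_connect clo)|].
    by rewrite zxy !inE => <-.
  move: zxy; rewrite !inE => /orP[]/eqP-> /orP[]/eqP->; rewrite ?connect0 //.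
have nyx : (y == x) = false by rewrite eq_sym; apply/negbTE.
apply/forallP=> -[[|[|//]] i]; apply/forallP=> -[[|[|//]] j];
  by rewrite !(tnth_nth x) Fadj /= ?eqxx ?(negPf nxy) ?nyx.
Qed.

Lemma laP (k : nat) (G : sgraph) : 0 < k ->
  (exists2 P, @forest_decomposition k G P & #|P| = la k G) /\
  (forall P, @forest_decomposition k G P -> la k G <= #|P|).
Proof.
move=> k0; rewrite /la; case: arg_minnP => [|P decP minP].
  exact: forest_decomposition_single_edges.
by split=> //; exists P.
Qed.

(* Main.v *)
Require Import Defs.
From mathcomp Require Import all_boot zify.

Set Implicit Arguments.
Unset Strict Implicit.
Unset Printing Implicit Defensive.

(** A graph is a linear k-forest iff its vertices carry a rank in 0..k (the
    position on the path of the vertex) that changes by exactly one along every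
    edge and separates the neighbours of each vertex.
    Given rankings of A in G and of B in H, the edges of A x B split into those
    along which both ranks move in the same direction and those along which
    they move in opposite directions; in either class the rank of the first
    coordinate is again such a ranking.  This gives the upper bound.  For the
    lower bound, a vertex has at most one neighbour above and one below it in
    each forest.  For G = H = P_3 and k = l = 2 the two bounds coincide. *)

(** * Rankings and the passage from linear forests to them *)

Record path_rank (k : nat) (G : sgraph) (r : G -> nat) : Prop := PathRank {
  path_rank_le : forall x, r x <= k;
  path_rank_adj : forall x y, adj x y -> r x = (r y).+1 \/ r y = (r x).+1;
  path_rank_nbr : forall x y z, adj x y -> adj x z -> r y = r z -> y = z }.

(** A neighbour of [x] has rank [r x + 1] or [r x - 1], so its side fixes its rank. *)
Lemma path_rank_side k (G : sgraph) (r : G -> nat) x y z :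
  path_rank k r -> adj x y -> adj x z -> (r x < r y) = (r x < r z) -> y = z.
Proof.
move=> rP xy xz side; apply: (path_rank_nbr rP xy xz).
by case: (path_rank_adj rP xy) (path_rank_adj rP xz) => ? [] ?; lia.
Qed.

Lemma linear_forest_path_rank k (G : sgraph) :
  linear_forest k G -> exists r, @path_rank k G r.
Proof.
case/andP=> _ /forallP linG.
have pathG (x : G) : exists t : seq G, [/\ size t <= k.+1,
    component x = [set y in t] &
    {in t &, forall u v, adj u v =
       ((index u t).+1 == index v t) || ((index v t).+1 == index u t)}].
  have /existsP[m /existsP[t /and3P[_ /eqP tC /forallP tadj]]] := linG x.
  exists t; split; [by rewrite size_tuple | exact: tC |].
  move=> u v ut vt.
  have ui : index u t < m.+1 by rewrite -[X in _ < X](size_tuple t) index_mem.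
  have vi : index v t < m.+1 by rewrite -[X in _ < X](size_tuple t) index_mem.
  have /forallP/(_ (Ordinal vi))/eqP := tadj (Ordinal ui).
  by rewrite !(tnth_nth x) /= !nth_index.
have [t tP] := fin_all_exists pathG.
have symG : connect_sym (@adj G) := sym_connect_sym (@adj_sym G).
(* Choosing the path at the root makes all vertices of a component share one list; the rank is the
   index in it. *)
pose s (x : G) := t (root (@adj G) x).
have mem_s x : x \in s x.
  have [_ /setP/(_ x) + _] := tP (root (@adj G) x).
  by rewrite !inE symG connect_root => <-.
have s_adj x y : adj x y -> s y = s x.
  by move=> xy; rewrite /s; congr t; apply/esym/rootP; rewrite ?connect1.
exists (fun x => index x (s x)); split=> [x|x y xy|x y z xy xz].
- have [sz _ _] := tP (root (@adj G) x); rewrite -ltnS.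
  by apply: leq_trans sz; rewrite index_mem.
- have [_ _ /(_ x y (mem_s x))] := tP (root (@adj G) x).
  rewrite -/(s x) -(s_adj _ _ xy) => /(_ (mem_s y)).
  by rewrite xy (s_adj _ _ xy) => /esym/orP[]/eqP <-; [right | left].
- rewrite (s_adj _ _ xy) (s_adj _ _ xz) => eq_yz.
  have ys : y \in s x by rewrite -(s_adj _ _ xy).
  have zs : z \in s x by rewrite -(s_adj _ _ xz).
  by rewrite -(nth_index x ys) eq_yz nth_index.
Qed.

(* A vertex of maximal rank on a cycle would have two neighbours below it. *)
Lemma path_rank_forest k (G : sgraph) (r : G -> nat) :
  path_rank k r -> forest G.
Proof.
move=> rP; apply/forallP=> m; apply/forallP=> c; apply/implyP=> m2.
apply/negP=> /andP[cyc Uc].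
have [x0 x0c] : exists x, x \in c.
  by exists (tnth c (Ordinal (ltnW (ltnW m2)))); apply: mem_tnth.
case: (@arg_maxnP _ x0 [in c] r x0c) => x xc maxx.
have xn : adj x (next c x) by apply: next_cycle.
have xp : adj x (prev c x) by rewrite adj_sym; apply: prev_cycle.
have eq_np : next c x = prev c x.
  apply: (path_rank_side rP xn xp).
  by apply/idP/idP; rewrite ltnNge => /negP[]; apply: maxx; rewrite /= ?mem_next ?mem_prev.
(* Two steps along the cycle lead back to [x], impossible with at least three distinct vertices. *)
have := next_prev Uc x; rewrite -eq_np => nnx.
have [i p def_p] := rot_to xc.
have Up : uniq (x :: p) by rewrite -def_p rot_uniq.
have sp : size (x :: p) = m by rewrite -def_p size_rot size_tuple.
move: nnx; rewrite -!(next_rot i Uc) def_p.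
case: p Up sp {def_p} => [|y [|z p]] /=; try by move=> _ sp; rewrite -sp in m2.
rewrite !inE !negb_or => /andP[/and3P[xy xz _] _] _.
by rewrite eqxx [y == x]eq_sym (negPf xy) eqxx => zx; rewrite zx eqxx in xz.
Qed.

(** * Components of a ranked graph are paths *)

Section RankedComponents.

Variables (k : nat) (G : sgraph) (r : G -> nat).
Hypothesis rP : path_rank k r.

(** The default [x] at the top of a path makes this a total function, whose [orbit] from the bottom
    lists the path. *)
Definition rank_succ (x : G) : G :=
  odflt x [pick y | adj x y && (r y == (r x).+1)].

Lemma rank_succ_adj x y : adj x y -> r y = (r x).+1 -> rank_succ x = y.
Proof.
move=> xy ry; rewrite /rank_succ; case: pickP => [z /andP[xz /eqP rz]|/(_ y)] /=.
  by apply: (path_rank_nbr rP xz xy); rewrite rz ry.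
by rewrite xy ry eqxx.
Qed.

Lemma rank_succP x :
  rank_succ x = x \/ (adj x (rank_succ x) /\ r (rank_succ x) = (r x).+1).
Proof.
rewrite /rank_succ; case: pickP => [z /andP[xz /eqP rz]|_] /=; last by left.
by right.
Qed.

(** The first [order] iterates are distinct, so the default value has not been reached yet. *)
Lemma rank_succ_orbit z i : i.+1 < order rank_succ z ->
  adj (iter i rank_succ z) (iter i.+1 rank_succ z) /\
  r (iter i.+1 rank_succ z) = (r (iter i rank_succ z)).+1.
Proof.
move=> lti; case: (rank_succP (iter i rank_succ z)) => // fix_i.
have := @nth_uniq _ z (orbit rank_succ z) i i.+1.
rewrite size_orbit => /(_ (ltnW lti) lti (orbit_uniq _ _)).
by rewrite /orbit !nth_traject ?(ltnW lti) //= fix_i eqxx; lia.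
Qed.

Lemma rank_orbit z i : i < order rank_succ z ->
  r (iter i rank_succ z) = r z + i.
Proof.
elim: i => [|i IHi] lti; first by rewrite addn0.
by rewrite (rank_succ_orbit lti).2 IHi ?addnS // ltnW.
Qed.

(** The orbit is closed under adjacency: an upper neighbour is the successor, a lower one is the
    preceding iterate by uniqueness, and [z] has no lower one by minimality. *)
Lemma component_orbit z : {in component z, forall y, r z <= r y} ->
  component z = [set y in orbit rank_succ z].
Proof.
move=> minz.
have symG : connect_sym (@adj G) := sym_connect_sym (@adj_sym G).
have orb_conn i : connect (@adj G) z (iter i rank_succ z).
  elim: i => [|i IHi] /=; first exact: connect0.
  apply: connect_trans IHi _.
  by case: (rank_succP (iter i rank_succ z)) => [->|[/connect1]].
have clo u v : adj u v -> u \in orbit rank_succ z -> v \in orbit rank_succ z.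
  move=> uv; rewrite -!fconnect_orbit => zu.
  have [i lti def_u] : exists2 i, i < order rank_succ z & u = iter i rank_succ z.
    by exists (findex rank_succ z u); rewrite ?findex_max ?iter_findex.
  case: (path_rank_adj rP uv) => ruv; last first.
    by rewrite -(rank_succ_adj uv ruv); apply: connect_trans zu (fconnect1 _ _).
  case: i def_u lti => [|i] def_u lti.
    have : v \in component z by rewrite inE connect1 // -[z]/(iter 0 rank_succ z) -def_u.
    by move/minz; rewrite {1}def_u /= in ruv; rewrite ruv ltnn.
  have [adj_i r_i] := rank_succ_orbit lti.
  rewrite -def_u in adj_i r_i; rewrite adj_sym in adj_i.
  rewrite (path_rank_nbr rP uv adj_i) ?fconnect_iter //.
  by apply/eq_add_S; rewrite -ruv.
have closed_orb : closed (@adj G) (mem (orbit rank_succ z)).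
  by apply: intro_closed => // u v; apply: clo.
apply/setP=> y; rewrite !inE; apply/idP/idP => [zy|].
  have := closed_connect closed_orb zy; rewrite /= => <-.
  by rewrite -fconnect_orbit connect0.
by rewrite -fconnect_orbit => /iter_findex <-.
Qed.

Lemma path_rank_linear_forest : linear_forest k G.
Proof.
rewrite /linear_forest (path_rank_forest rP) /=; apply/forallP=> x.
have symG : connect_sym (@adj G) := sym_connect_sym (@adj_sym G).
have xx : x \in component x by rewrite inE connect0.
case: (@arg_minnP _ x [in component x] r xx) => z; rewrite /= inE => xz minz.
have eqC : component x = component z.
  by apply/setP=> y; rewrite !inE (same_connect symG xz).
have {minz} minz : {in component z, forall y, r z <= r y}.
  by move=> y yC; apply: minz; rewrite /= eqC.
have := component_orbit minz; rewrite -eqC => {}eqC.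
have sz : size (orbit rank_succ z) == (order rank_succ z).-1.+1.
  by rewrite size_orbit orderSpred.
(* The last vertex of the orbit has rank [r z + (order - 1)], which is at most [k]. *)
have ltk : (order rank_succ z).-1 < k.+1.
  rewrite ltnS; apply: leq_trans (path_rank_le rP (iter (order rank_succ z).-1 rank_succ z)).
  by rewrite rank_orbit ?leq_addl // orderSpred.
apply/existsP; exists (Ordinal ltk); apply/existsP; exists (Tuple sz).
rewrite [tval _]/(orbit rank_succ z) orbit_uniq eqC eqxx /=.
apply/forallP=> i; apply/forallP=> j.
have lti : i < order rank_succ z by apply: leq_trans (ltn_ord i) _; rewrite orderSpred.
have ltj : j < order rank_succ z by apply: leq_trans (ltn_ord j) _; rewrite orderSpred.
rewrite !(tnth_nth z) /= /orbit !nth_traject //.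
apply/eqP; apply/idP/orP => [/(path_rank_adj rP)|].
  by rewrite !rank_orbit // => -[] ?; [right | left]; apply/eqP; lia.
case=> /eqP ij; move: lti ltj; rewrite -ij => lti ltj.
  exact: (rank_succ_orbit ltj).1.
by rewrite adj_sym; apply: (rank_succ_orbit lti).1.
Qed.

End RankedComponents.

(** * Decompositions and edge colourings *)

Lemma forest_decomposition_ranks k (G : sgraph) (P : {set {set {set G}}}) :
  forest_decomposition k P ->
  exists r : {set {set G}} -> G -> nat,
    forall S, S \in P -> @path_rank k (edge_subgraph S) (r S).
Proof.
case/andP=> _ /forall_inP linP.
have ranks S : exists r : G -> nat, S \in P -> @path_rank k (edge_subgraph S) r.
  have [SP|_] := boolP (S \in P); last by exists (fun=> 0).
  by have [r rP] := linear_forest_path_rank (linP S SP); exists r.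
exact: fin_all_exists ranks.
Qed.

Lemma decomposition_block k (G : sgraph) (P : {set {set {set G}}}) (x y : G) :
  forest_decomposition k P -> adj x y ->
  pblock P [set x; y] \in P /\
  @adj (edge_subgraph (pblock P [set x; y])) x y.
Proof.
case/andP=> /cover_partition covP _ xy.
have eE : [set x; y] \in cover P by rewrite covP; apply/edgesP; exists x, y.
by rewrite pblock_mem //; split=> //; apply/andP; rewrite mem_pblock.
Qed.

(** The nonempty colour classes form a decomposition. Empty classes are no blocks, so there may be
    fewer blocks than colours. *)
Lemma la_le_colours k (G : sgraph) (I : finType) (D : {set I})
    (c : {set G} -> I) :
  0 < k -> {in edges G, forall e, c e \in D} ->
  (forall i, exists r,
     @path_rank k (edge_subgraph [set e in edges G | c e == i]) r) ->
  la k G <= #|D|.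
Proof.
move=> k0 cD cr; pose cl i := [set e in edges G | c e == i].
have [_ la_min] := laP G k0.
have blocks S : S \in preim_partition c (edges G) -> exists2 i, i \in D & S = cl i.
  case/imsetP=> e eE ->; exists (c e); first exact: cD.
  by apply/setP=> f; rewrite !inE [c f == _]eq_sym.
apply: leq_trans (la_min (preim_partition c (edges G)) _) _.
  rewrite /forest_decomposition preim_partitionP; apply/forall_inP=> S /blocks[i _ ->].
  by have [r rP] := cr i; apply: path_rank_linear_forest rP.
apply: leq_trans (leq_imset_card cl D).
by apply/subset_leq_card/subsetP=> S /blocks[i iD ->]; apply: imset_f.
Qed.

(** * The lower bound *)

Lemma degree_le_decomposition k (G : sgraph) (P : {set {set {set G}}}) (x : G) :
  forest_decomposition k P -> degree x <= #|P| * 2.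
Proof.
move=> decP; have [r rP] := forest_decomposition_ranks decP.
pose f y := let S := pblock P [set x; y] in (S, r S x < r S y).
have f_inj : {in [set y | adj x y] &, injective f}.
  move=> y z; rewrite !inE => xy xz [eqS side].
  have [SP xyS] := decomposition_block decP xy.
  have [_ xzS] := decomposition_block decP xz.
  rewrite -eqS in xzS side.
  exact: path_rank_side (rP _ SP) xyS xzS side.
rewrite /degree -(card_in_imset f_inj) -[2]card_bool -cardsT -cardsX.
apply/subset_leq_card/subsetP=> t /imsetP[y]; rewrite inE => xy ->.
by rewrite !inE (decomposition_block decP xy).1.
Qed.

(** Positivity excludes the graph without vertices, whose maximum is empty. *)
Lemma max_degree_attained (G : sgraph) :
  0 < max_degree G -> exists x : G, max_degree G = degree x.
Proof.
move=> dG; have [G0|G0] := posnP #|G|; last first.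
  by have [x dx] := eq_bigmax (@degree G) G0; exists x.
move: dG; rewrite /max_degree big_pred0 // => x.
by have /card0_eq/(_ x) := G0.
Qed.

Lemma degree_direct_product (G H : sgraph) (x : G) (y : H) :
  @degree (direct_product G H) (x, y) = degree x * degree y.
Proof. by rewrite /degree -cardsX; apply: eq_card => p; rewrite !inE. Qed.

Lemma la_direct_product_ge (G H : sgraph) k : 0 < k ->
  uphalf (max_degree G * max_degree H) <= la k (direct_product G H).
Proof.
move=> k0; have [[P decP <-] _] := laP (direct_product G H) k0.
have [->//|] := posnP (max_degree G * max_degree H).
rewrite muln_gt0 => /andP[/max_degree_attained[x ->] /max_degree_attained[y ->]].
have := @degree_le_decomposition _ (direct_product G H) P (x, y) decP; rewrite degree_direct_product.
by lia.
Qed.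

(** * The upper bound *)

Lemma la_direct_product_le (G H : sgraph) k l m :
  0 < k -> 0 < l -> k <= m ->
  la m (direct_product G H) <= 2 * la k G * la l H.
Proof.
move=> k0 l0 km.
have [[P decP <-] _] := laP G k0; have [[Q decQ <-] _] := laP H l0.
have [r rP] := forest_decomposition_ranks decP.
have [s sQ] := forest_decomposition_ranks decQ.
pose GH := direct_product G H.
pose blk1 (e : {set GH}) := pblock P [set p.1 | p in e].
pose blk2 (e : {set GH}) := pblock Q [set p.2 | p in e].
(* An edge is unordered, so the test asks for some order of its ends in which both ranks rise. *)
pose same_dir (e : {set GH}) := [exists p in e, exists q in e,
  (r (blk1 e) p.1 < r (blk1 e) q.1) && (s (blk2 e) p.2 < s (blk2 e) q.2)].
pose c e := (blk1 e, blk2 e, same_dir e).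
(* Decodes a colour for an ordered edge: ranks of adjacent vertices differ, so equal comparisons
   mean that both rise or both fall. *)
have cP (p q : GH) S T b : adj p q -> c [set p; q] = (S, T, b) ->
  [/\ S \in P, T \in Q, @adj (edge_subgraph S) p.1 q.1,
      @adj (edge_subgraph T) p.2 q.2 &
      b = ((r S p.1 < r S q.1) == (s T p.2 < s T q.2))].
  case/andP=> pq1 pq2 [def_S def_T def_b].
  rewrite /same_dir def_S def_T in def_b.
  rewrite /blk1 imsetU1 imset_set1 in def_S.
  rewrite /blk2 imsetU1 imset_set1 in def_T.
  have [] := decomposition_block decP pq1; rewrite def_S => SP pqS.
  have [] := decomposition_block decQ pq2; rewrite def_T => TQ pqT.
  split=> //; rewrite -def_b.
  have /= rpq := path_rank_adj (rP _ SP) pqS.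
  have /= spq := path_rank_adj (sQ _ TQ) pqT.
  apply/exists_inP/idP => [[u upq /exists_inP[v vpq]]|dir].
    by move: upq vpq; rewrite !inE => /orP[]/eqP-> /orP[]/eqP->; lia.
  have [lt_pq|ge_pq] := ltnP (r S p.1) (r S q.1).
    exists p; rewrite ?set21 //; apply/exists_inP; exists q; rewrite ?set22 //.
    by lia.
  exists q; rewrite ?set22 //; apply/exists_inP; exists p; rewrite ?set21 //.
  by lia.
have -> : 2 * #|P| * #|Q| = #|setX (setX P Q) [set: bool]|.
  by rewrite !cardsX cardsT card_bool [RHS]mulnC mulnA.
apply: (@la_le_colours m GH _ _ c); first exact: leq_trans k0 km.
  move=> e /edgesP[p [q [pq ->]]].
  by have [] := cP _ _ _ _ _ pq erefl; rewrite !inE => -> ->.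
move=> [[S T] b]; set F := edge_subgraph _.
have FP (p q : F) : adj p q -> [/\ S \in P, T \in Q,
    @adj (edge_subgraph S) p.1 q.1, @adj (edge_subgraph T) p.2 q.2 &
    b = ((r S p.1 < r S q.1) == (s T p.2 < s T q.2))].
  by case/andP=> pq; rewrite inE => /andP[_ /eqP]; apply: cP.
(* For [S] outside [P] the class has no edges and any constant rank works. *)
have [SP|nSP] := boolP (S \in P); last first.
  by exists (fun=> 0); split=> // p q => [|t] /FP[SP]; rewrite SP in nSP.
exists (fun p => r S p.1); split=> [p|p q /FP[_ _ pq _ _]|p q t].
- exact: leq_trans (path_rank_le (rP _ SP) p.1) km.
- exact: path_rank_adj (rP _ SP) _ _ pq.
- move=> /FP[_ TQ pq1 pq2 bq] /FP[_ _ pt1 pt2 bt] eq_r.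
  have eq1 : q.1 = t.1 := path_rank_nbr (rP _ SP) pq1 pt1 eq_r.
  have eq2 : q.2 = t.2.
    (* Equal ranks give the same direction in the first factor, and the common [b] transfers this to
       the second. *)
    by apply: (path_rank_side (sQ _ TQ) pq2 pt2); lia.
  by rewrite (surjective_pairing q) eq1 eq2 -surjective_pairing.
Qed.

(** * Sharpness on the path with three vertices *)

Definition path3_adj : rel 'I_3 := [rel i j : 'I_3 | (i.+1 == j) || (j.+1 == i)].

Lemma path3_adj_sym : symmetric path3_adj.
Proof. by move=> i j; rewrite /path3_adj /= orbC. Qed.

Lemma path3_adj_irrefl : irreflexive path3_adj.
Proof. by move=> i; rewrite /path3_adj /=; lia. Qed.

Definition path3 : sgraph := SGraph path3_adj_sym path3_adj_irrefl.

(** Keeps the sharpness example from being the degenerate edgeless one. *)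
Lemma edges_path3 : edges path3 != set0.
Proof.
pose x0 : path3 := ord0; pose x1 : path3 := Ordinal (isT : 1 < 3).
by apply/set0Pn; exists [set x0; x1]; apply/edgesP; exists x0, x1.
Qed.

Lemma max_degree_path3 : 2 <= max_degree path3.
Proof.
pose x1 : path3 := Ordinal (isT : 1 < 3); apply: leq_trans (leq_bigmax x1).
have <- : #|[set (ord0 : 'I_3); ord_max]| = 2 by rewrite cards2.
apply/subset_leq_card/subsetP=> i.
by rewrite !inE => /orP[]/eqP->.
Qed.

Lemma la_path3 : la 2 path3 <= 1.
Proof.
rewrite -[X in _ <= X](cards1 tt).
apply: (@la_le_colours _ _ _ _ (fun=> tt)) => // [e _|i]; first by rewrite inE.
(* All edges get one colour, and each vertex is its own rank. *)
exists (@nat_of_ord 3); split=> [x|x y /andP[+ _]|x y z _ _ /val_inj //].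
  exact: (ltn_ord (x : 'I_3)).
by case/orP=> /eqP; [right | left].
Qed.

(** One-sided estimates suffice: the lower bound is at least [uphalf (2 * 2) = 2] and the upper one
    at most [2 * 1 * 1]. *)
Lemma la_direct_product_path3 :
  la 2 (direct_product path3 path3) = 2 * la 2 path3 * la 2 path3 /\
  la 2 (direct_product path3 path3) = uphalf (max_degree path3 * max_degree path3).
Proof.
have := @la_direct_product_ge path3 path3 2 isT.
have := @la_direct_product_le path3 path3 2 2 2 isT isT isT.
have := max_degree_path3; have := la_path3.
by nia.
Qed.

Theorem theorem2p10 :
  (forall (G H : sgraph) (k l : nat), 0 < k -> 0 < l ->
     uphalf (max_degree G * max_degree H) <= la (maxn k l) (direct_product G H)
     /\ la (maxn k l) (direct_product G H) <= 2 * la k G * la l H)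
  /\ (exists (G H : sgraph) (k l : nat),
        [/\ 0 < k, 0 < l, edges G != set0, edges H != set0 &
            la (maxn k l) (direct_product G H)
              = uphalf (max_degree G * max_degree H)])
  /\ (exists (G H : sgraph) (k l : nat),
        [/\ 0 < k, 0 < l, edges G != set0, edges H != set0 &
            la (maxn k l) (direct_product G H) = 2 * la k G * la l H]).
Proof.
have [eq_upper eq_lower] := la_direct_product_path3.
split; last by split; exists path3, path3, 2, 2; split=> //; exact: edges_path3.
move=> G H k l k0 l0; split; first by apply: la_direct_product_ge; rewrite leq_max k0.
by apply: la_direct_product_le; rewrite // leq_maxl.
Qed.
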